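(* Let $p$ be an odd prime and let $\alpha \in \mathbb{F}_p$ be a quadratic non-residue if $p \equiv 1 \pmod 4$, and a nonzero quadratic residue otherwise. Then the set $$A = \{(x_1,x_2,x_3) \in \mathbb{F}_p^3 : x_1^2 + x_2^2 + x_3^2 = \alpha\}$$ is a $C_3[3]$-set in the (additive) group $\mathbb{F}_p^3$, and $|A| \geq p^2 - p$.
   Context: Let $\Gamma$ be an abelian group and $g \geq h \geq 2$ integers. A set $A \subset \Gamma$ is a $C_h[g]$-set if, for any set $X \subset \Gamma$ with $|X| = h$ and any set $\{k_1,\dots,k_g\} \subset \Gamma$ of $g$ distinct elements, at least one of the translates $X + k_i := \{x + k_i : x \in X\}$ is not contained in $A$. Here $g=h=3$. *)

(* Defs.v *)
(* MathComp, with finmap for finite subsets of a possibly infinite group. *)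
From mathcomp Require Import all_boot all_algebra.
From mathcomp Require Import finmap.

Set Implicit Arguments.
Unset Strict Implicit.
Unset Printing Implicit Defensive.

Import GRing.Theory.
Local Open Scope ring_scope.

Definition translate (G : zmodType) (X : {fset G}) (k : G) : {fset G} :=
  [fset (x + k)%R | x in X]%fset.

(* C_h[g]-sets; the usual convention is 2 <= h <= g, which is not imposed here.
   K is the set {k_1, ..., k_g} of translation vectors. *)
Definition C_set (h g : nat) (G : zmodType) (A : {pred G}) : Prop :=
  forall X K : {fset G}, #|` X| = h -> #|` K| = g ->
    exists2 k, k \in K & ~ {subset translate X k <= A}.

(* With this convention 0 is a quadratic residue. *)
Definition quadratic_residue (F : fieldType) (a : F) : Prop :=
  exists y : F, y ^+ 2 = a.

Definition sphere (F : finFieldType) (a : F) : {set 'rV[F]_3} :=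
  [set x : 'rV[F]_3 | x 0 0 ^+ 2 + x 0 1 ^+ 2 + x 0 2 ^+ 2 == a].

(* Main.v *)
(** Write q(x) = x_1^2 + x_2^2 + x_3^2.  In both cases -alpha is not a square.

    A line on the sphere q = alpha has an isotropic direction d orthogonal to
    its points, and q takes only values -s^2 on the orthogonal of d; so the
    sphere contains no line, hence no three collinear points.  If nine sums
    x_i + k_j lie on the sphere, the vectors x_i - x_1 are orthogonal to the
    vectors k_j - k_1; each of the two families spans a plane, which is
    impossible in dimension 3.

    For the cardinality, -1 is a sum of two squares, so q is equivalent to
    2st - w^2; every w and every s <> 0 then determine a point of the sphere. *)
Require Import Defs.
From mathcomp Require Import all_boot all_algebra.
From mathcomp Require Import finmap.
From mathcomp Require Import fingroup cyclic finfield ring.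

Set Implicit Arguments.
Unset Strict Implicit.
Unset Printing Implicit Defensive.

Import GRing.Theory.
Local Open Scope ring_scope.

Definition dot (F : fieldType) (u v : 'rV[F]_3) : F :=
  u 0 0 * v 0 0 + u 0 1 * v 0 1 + u 0 2 * v 0 2.

(** Turns orthogonality into a vanishing matrix product, so that rank bounds apply. *)
Lemma dotE (F : fieldType) (u v : 'rV[F]_3) : dot u v = (u *m v^T) 0 0.
Proof.
rewrite mxE /dot !big_ord_recl big_ord0 !mxE addr0 addrA.
by congr (_ + u _ _ * v _ _ + u _ _ * v _ _); apply/val_inj.
Qed.

Lemma row3P (F : fieldType) (u v : 'rV[F]_3) :
  u 0 0 = v 0 0 -> u 0 1 = v 0 1 -> u 0 2 = v 0 2 -> u = v.
Proof.
move=> e0 e1 e2; apply/rowP => -[[|[|[|//]]] lti].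
- by rewrite [Ordinal _](_ : _ = 0) //; apply/val_inj.
- by rewrite [Ordinal _](_ : _ = 1) //; apply/val_inj.
- by rewrite [Ordinal _](_ : _ = 2) //; apply/val_inj.
Qed.

(** By Lagrange in the additive group, [#|F|] is 0 in [F]; if 2 were 0, an odd [#|F|] would be 1
    there. *)
Lemma odd_card_two_neq0 (F : finFieldType) : odd #|F| -> (2%:R : F) != 0.
Proof.
move=> oddF; apply: contraNneq (oner_neq0 F) => two.
have cF0 : #|F|%:R = 0 :> F.
  have := @expg_cardG _ [set: F]%G (1%R : F) (in_setT _).
  by rewrite cardsT FinRing.zmodXgE.
rewrite -[X in _ == X]cF0 -(odd_double_half #|F|) oddF natrD -mul2n natrM two.
by rewrite mul0r addr0.
Qed.

Lemma in_sphere (F : finFieldType) (a : F) (x : 'rV[F]_3) :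
  (x \in sphere a) = (dot x x == a).
Proof. by rewrite inE /dot -!expr2. Qed.

Lemma dotDD (F : fieldType) (y u : 'rV[F]_3) :
  dot (y + u) (y + u) = dot y y + 2%:R * dot y u + dot u u.
Proof. by rewrite /dot !mxE; ring. Qed.

Lemma opp_dot_square (F : fieldType) (y v : 'rV[F]_3) :
  v != 0 -> dot v v = 0 -> dot y v = 0 -> quadratic_residue (- dot y y).
Proof.
move=> v0 vv yv.
(* The root is the first coordinate of the cross product of y and v, divided by a. A zero first
   coordinate of [v] is handled below by permuting coordinates. *)
have key (a b c y1 y2 y3 : F) : a != 0 -> a * a + b * b + c * c = 0 ->
    y1 * a + y2 * b + y3 * c = 0 ->
    quadratic_residue (- (y1 * y1 + y2 * y2 + y3 * y3)).
  move=> a0 q0 d0; exists ((c * y2 - b * y3) / a).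
  have ea : a * a = - (b * b + c * c)
    by apply/eqP; rewrite -addr_eq0 addrA q0.
  have ey : y1 * a = - (y2 * b + y3 * c)
    by apply/eqP; rewrite -addr_eq0 addrA d0.
  apply: (mulfI (mulf_neq0 a0 a0)).
  rewrite [LHS](_ : _ = (c * y2 - b * y3) ^+ 2); last by field.
  rewrite [RHS](_ : _ =
    - ((y1 * a) * (y1 * a) + (a * a) * (y2 * y2 + y3 * y3))); last by ring.
  by rewrite ey ea; ring.
rewrite /dot in vv yv.
have [v00|] := eqVneq (v 0 0) 0; last by move=> v00; exact: key v00 vv yv.
have [v01|v01] := eqVneq (v 0 1) 0; last first.
  rewrite [dot y y](_ : _ = y 0 1 * y 0 1 + y 0 0 * y 0 0 + y 0 2 * y 0 2).
    by apply: (key _ (v 0 0) (v 0 2) _ _ _ v01);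
      [rewrite -[RHS]vv | rewrite -[RHS]yv]; ring.
  by rewrite /dot; ring.
have [v02|v02] := eqVneq (v 0 2) 0.
  by case/eqP: v0; apply: row3P; rewrite mxE.
rewrite [dot y y](_ : _ = y 0 2 * y 0 2 + y 0 1 * y 0 1 + y 0 0 * y 0 0).
  by apply: (key _ (v 0 1) (v 0 0) _ _ _ v02);
    [rewrite -[RHS]vv | rewrite -[RHS]yv]; ring.
by rewrite /dot; ring.
Qed.

(** If v = c u, the polynomial q(y + t u) - a = t (2 y.u + t u.u) vanishes at the distinct points 0,
    1, c, so u is isotropic and orthogonal to y. *)
Lemma sphere_not_collinear (F : finFieldType) (a : F) (y u v : 'rV[F]_3) :
  ~ quadratic_residue (- a) -> (2%:R : F) != 0 ->
  u != 0 -> v != 0 -> v != u ->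
  y \in sphere a -> y + u \in sphere a -> y + v \in sphere a ->
  \rank (col_mx u v) = 2.
Proof.
move=> nsq two u0 v0 vu; rewrite !in_sphere !dotDD => /eqP ya /eqP yu /eqP yv.
apply/eqP; rewrite eqn_leq rank_leq_row ltnNge; apply/negP => rk1.
have: (v <= u)%MS.
  have uc : (u <= col_mx u v)%MS by rewrite -addsmxE addsmxSl.
  have : (u == col_mx u v)%MS.
    by rewrite -(mxrank_leqif_eq uc) eqn_leq mxrankS // rank_rV u0.
  by case/andP => _; apply: submx_trans; rewrite -addsmxE addsmxSr.
case/sub_rVP => c def_v; rewrite {}def_v in v0 vu yv.
have c0 : c != 0 by apply: contraNneq v0 => ->; rewrite scale0r.
have c1 : c - 1 != 0.
  by rewrite subr_eq0; apply: contraNneq vu => ->; rewrite scale1r.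
have eu : 2%:R * dot y u + dot u u = 0.
  by rewrite ya -addrA in yu; apply: (addrI a); rewrite yu addr0.
have ev : c * (2%:R * dot y u + c * dot u u) = 0.
  apply: (addrI a); rewrite addr0 -[RHS]yv ya /dot !mxE; ring.
have uu : dot u u = 0.
  apply: (mulfI (mulf_neq0 c0 c1)); rewrite mulr0.
  rewrite [LHS](_ : _ = c * (2%:R * dot y u + c * dot u u)
    - c * (2%:R * dot y u + dot u u)); last by ring.
  by rewrite ev eu mulr0 subrr.
have yu0 : dot y u = 0.
  by apply: (mulfI two); rewrite mulr0 -eu uu addr0.
by apply: nsq; rewrite -ya; apply: opp_dot_square u0 uu yu0.
Qed.

(** The second difference of q in the directions u and v is 2 u.v. *)
Lemma sphere_dot_eq0 (F : finFieldType) (a : F) (y u v : 'rV[F]_3) :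
  (2%:R : F) != 0 -> y \in sphere a -> y + u \in sphere a ->
  y + v \in sphere a -> y + u + v \in sphere a -> dot u v = 0.
Proof.
move=> two; rewrite !in_sphere => /eqP e /eqP eu /eqP ev /eqP euv.
apply: (mulfI two); rewrite mulr0.
rewrite [LHS](_ : _ = (dot (y + u + v) (y + u + v) - dot (y + u) (y + u))
  - (dot (y + v) (y + v) - dot y y)); last by rewrite /dot !mxE; ring.
by rewrite e eu ev euv !subrr.
Qed.

Lemma C_set_sphere (F : finFieldType) (a : F) :
  odd #|F| -> ~ quadratic_residue (- a) -> C_set 3 3 (sphere a).
Proof.
move=> /odd_card_two_neq0 two nsq X K cX cK.
have [/hasP[k kK /allPn nall]|] :=
    boolP (has (fun k => ~~ all (mem (sphere a)) (translate X k)) K).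
  by exists k => // sub; case: nall => x xX /negP; apply; apply: sub.
move/hasPn => allA; exfalso.
have {allA} A x k : x \in X -> k \in K -> x + k \in sphere a.
  move=> xX kK; have /negPn/allP := allA k kK; apply.
  by apply/imfsetP; exists x.
have three (Y : {fset 'rV[F]_3}) : #|` Y| = 3 -> exists y1 y2 y3,
    [/\ [/\ y1 \in Y, y2 \in Y & y3 \in Y], y2 - y1 != 0, y3 - y1 != 0
      & y3 - y1 != y2 - y1].
  move=> cY; have := fset_uniq Y.
  have memY x : (x \in Y) = (x \in enum_fset Y) by [].
  move: cY memY.
  case: (enum_fset Y) => [|y1 [|y2 [|y3 [|//]]]] // _ memY.
  rewrite /= !inE !negb_or !andbT => /andP[/andP[n12 n13] n23].
  exists y1, y2, y3; rewrite !subr_eq0 (inj_eq (addIr _)) !memY !inE.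
  rewrite !eqxx !orbT.
  by split=> //; rewrite eq_sym.
have [x1 [x2 [x3 [[x1X x2X x3X] x21 x31 x32]]]] := three X cX.
have [k1 [k2 [k3 [[k1K k2K k3K] k21 k31 k32]]]] := three K cK.
(* All nine sums are written from the base point [x1 + k1]. *)
have ex x : x1 + k1 + (x - x1) = x + k1 by rewrite addrC addrA subrK.
have ek k : x1 + k1 + (k - k1) = x1 + k by rewrite -addrA [k1 + _]addrC subrK.
have exk x k : x1 + k1 + (x - x1) + (k - k1) = x + k.
  by rewrite ex -addrA [k1 + _]addrC subrK.
have rX : \rank (col_mx (x2 - x1) (x3 - x1)) = 2.
  by apply: (sphere_not_collinear (y := x1 + k1) nsq two); rewrite ?ex ?A.
have rK : \rank (col_mx (k2 - k1) (k3 - k1)) = 2.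
  by apply: (sphere_not_collinear (y := x1 + k1) nsq two); rewrite ?ek ?A.
have orth x k : x \in X -> k \in K -> (x - x1) *m (k - k1)^T = 0.
  move=> xX kK; apply/rowP => i; rewrite !ord1 -dotE mxE.
  by apply: (sphere_dot_eq0 (a := a) (y := x1 + k1) two);
    rewrite ?exk ?ex ?ek A.
have : col_mx (x2 - x1) (x3 - x1) *m (col_mx (k2 - k1) (k3 - k1))^T = 0.
  by rewrite tr_col_mx mul_col_row !orth // block_mx0.
(* A zero product through dimension 3 bounds the sum of the ranks by 3, but 2 + 2 = 4. *)
by move/mulmx0_rank_max; rewrite mxrank_tr rX rK.
Qed.

(** Squaring has fibres of size at most 2, so the set S of squares has more than half of the
    elements of the odd field, and S meets c - S. *)
Lemma sum_two_squares (F : finFieldType) (c : F) :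
  odd #|F| -> exists x y : F, x ^+ 2 + y ^+ 2 = c.
Proof.
move=> oddF; pose S := [set x ^+ 2 | x : F].
have cS : (#|F| <= #|S| * 2)%N.
  rewrite -[X in (X <= _)%N]sum1_card.
  rewrite (partition_big_imset (fun x : F => x ^+ 2)).
  rewrite -sum_nat_const.
  apply: leq_sum => _ /imsetP[x _ ->]; rewrite sum1dep_card.
  apply: leq_trans (_ : #|[set x; - x]| <= 2)%N; last first.
    by rewrite cards2; case: eqP.
  by apply/subset_leq_card/subsetP => y; rewrite !inE eqf_sqr.
pose T := [set c - x | x in S].
have cT : #|T| = #|S| by apply: card_imset; apply: subrI.
have : S :&: T != set0.
  apply: contraTneq oddF => ST0.
  have := cardsUI S T; rewrite ST0 cards0 addn0 cT addnn => e.
  have := max_card (S :|: T); rewrite e -muln2 => le.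
  rewrite (_ : #|F| = #|S| * 2)%N ?oddM ?andbF //.
  by apply/eqP; rewrite eqn_leq cS.
case/set0Pn => z /setIP[/imsetP[x _ ->] /imsetP[w /imsetP[y _ ->] e]].
by exists x, y; rewrite e subrK.
Qed.

Lemma card_sphere_ge (F : finFieldType) (a : F) :
  odd #|F| -> (#|F| ^ 2 - #|F| <= #|sphere a|)%N.
Proof.
move=> oddF; have two := odd_card_two_neq0 oddF.
have [b [c bc]] := sum_two_squares (-1) oddF.
(* s e + t f + w n with e = (1, b, c), f = (1, -b, -c) / 2, n = (0, c, -b):
   e and f are isotropic, e.f = 1, and n.n = -1 with n orthogonal to both. *)
pose pt (s t w : F) : 'rV[F]_3 :=
  \row_j [:: s + t / 2; b * s - b * t / 2 + c * w;
              c * s - c * t / 2 - b * w]`_j.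
have q_pt s t w : dot (pt s t w) (pt s t w) = 2%:R * s * t - w ^+ 2.
  have -> : dot (pt s t w) (pt s t w) =
      (s + t / 2) ^+ 2 + (b ^+ 2 + c ^+ 2) * ((s - t / 2) ^+ 2 + w ^+ 2).
    by rewrite /dot !mxE /=; field.
  by rewrite bc; field.
(* Pairing with 2f recovers 2s, and pairing with -n recovers w, whatever t is. *)
have pt_s s t w : pt s t w 0 0 - b * pt s t w 0 1 - c * pt s t w 0 2 = 2%:R * s.
  rewrite [LHS](_ : _ = s + t / 2 - (b ^+ 2 + c ^+ 2) * (s - t / 2)).
    by rewrite bc; field.
  by rewrite !mxE /=; field.
have pt_w s t w : b * pt s t w 0 2 - c * pt s t w 0 1 = w.
  rewrite [LHS](_ : _ = - (b ^+ 2 + c ^+ 2) * w).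
    by rewrite bc opprK mul1r.
  by rewrite !mxE /=; field.
(* The middle argument solves 2st - w^2 = a for t when s is nonzero. *)
pose f (z : F * F) := pt z.1 ((a + z.2 ^+ 2) / (2%:R * z.1)) z.2.
pose D := [set z : F * F | z.1 != 0].
have cD : #|D| = (#|F| ^ 2 - #|F|)%N.
  have -> : D = setX [set~ 0] setT by apply/setP => z; rewrite !inE andbT.
  by rewrite cardsX cardsC1 cardsT expnS expn1 -subn1 mulnBl mul1n.
have f_inj : injective f.
  move=> [s w] [s' w'] e.
  have := congr1 (fun x : 'rV_3 => x 0 0 - b * x 0 1 - c * x 0 2) e.
  rewrite /= !pt_s => /(mulfI two) /= ->.
  have := congr1 (fun x : 'rV_3 => b * x 0 2 - c * x 0 1) e.
  by rewrite /= !pt_w => /= ->.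
rewrite -cD -(card_imset D f_inj); apply/subset_leq_card/subsetP => x.
case/imsetP => -[s w]; rewrite inE /= => s0 ->.
rewrite in_sphere q_pt; apply/eqP; field.
by rewrite s0.
Qed.

(** For a generator z of the multiplicative group, z^((#|F|-1)/4) has fourth power 1 but its square
    is not 1, so that square is -1. *)
Lemma opp1_square (F : finFieldType) :
  (#|F| = 1 %[mod 4])%N -> quadratic_residue (-1 : F).
Proof.
move=> card1; have card_gt1 := finNzRing_gt1 F.
have d4 : (4 %| #|F|.-1)%N.
  by rewrite -subn1 -eqn_mod_dvd ?(ltnW card_gt1) //; apply/eqP.
have card_gt0 : (0 < #|F|.-1)%N by rewrite -subn1 subn_gt0.
have : has #|F|.-1.-primitive_root (enum [set~ (0 : F)]).
  apply: has_prim_root; rewrite ?enum_uniq -?cardE ?cardsC1 //.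
  apply/allP => x; rewrite mem_enum !inE => x0; rewrite unity_rootE.
  apply/eqP/(mulfI x0).
  by rewrite mulr1 -exprS prednK ?(ltnW card_gt1) // expf_card.
case/hasP => z _ prim_z; exists (z ^+ (#|F|.-1 %/ 4)).
have : (z ^+ (#|F|.-1 %/ 4)) ^+ 2 ^+ 2 == 1.
  by rewrite -!exprM -[(2 * 2)%N]/4%N divnK // prim_expr_order.
rewrite sqrf_eq1 => /orP[|/eqP //].
rewrite -exprM -(prim_order_dvd prim_z) => /dvdn_leq.
rewrite muln_gt0 andbT divn_gt0 // dvdn_leq // -[leqLHS](divnK d4).
have q0 : (0 < #|F|.-1 %/ 4)%N by rewrite divn_gt0 // dvdn_leq.
by rewrite leq_pmul2l // => /(_ isT).
Qed.

(** With #|F| = 4m+3 and x^2 = -1, Fermat gives 1 = x^(2(2m+1)) = (-1)^(2m+1) = -1, against 2 being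
    nonzero. *)
Lemma opp1_not_square (F : finFieldType) :
  (#|F| = 3 %[mod 4])%N -> ~ quadratic_residue (-1 : F).
Proof.
move=> card3 [x x2]; have := divn_eq #|F| 4; rewrite card3 => eF.
have oddF : odd #|F| by rewrite eF oddD oddM andbF.
have two := odd_card_two_neq0 oddF.
have x0 : x != 0.
  apply: contra_eqN x2 => /eqP->.
  by rewrite expr0n eq_sym oppr_eq0 oner_eq0.
have := expf_card x.
rewrite eF (_ : 3 %% 4 = 3)%N // addnS exprS -[RHS]mulr1 => /(mulfI x0)/eqP.
rewrite (_ : _ + 2 = 2 * (#|F| %/ 4 * 2).+1)%N; last first.
  by rewrite [RHS]mulnS addnC mulnCA.
rewrite exprM x2 exprS exprM sqrr_sign mulN1r eq_sym -subr_eq0 opprK.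
exact/negP.
Qed.

Theorem theorem2 (p : nat) (alpha : 'F_p)
    (p_prime : prime p) (p_odd : odd p)
    (alpha_1mod4 : (p = 1 %[mod 4])%N -> ~ quadratic_residue alpha)
    (alpha_other : (p <> 1 %[mod 4])%N -> alpha != 0 /\ quadratic_residue alpha) :
  C_set 3 3 (sphere alpha) /\ (p ^ 2 - p <= #|sphere alpha|)%N.
Proof.
have cF : #|'F_p| = p by rewrite card_Fp.
have nsq : ~ quadratic_residue (- alpha).
  case=> s es; have [p1|/eqP p3] := eqVneq (p %% 4)%N (1 %% 4)%N.
    have [i ei] := @opp1_square 'F_p (etrans (congr1 (modn^~ 4) cF) p1).
    (* Here i^2 = -1 and s^2 = -alpha, so (i s)^2 = alpha. *)
    apply: (alpha_1mod4 p1); exists (i * s).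
    by rewrite exprMn ei es mulrNN mul1r.
  have [a0 [r er]] := alpha_other p3.
  have pm3 : (#|'F_p| = 3 %[mod 4])%N.
    rewrite cF; move: p3 p_odd; rewrite [in odd _](divn_eq p 4) oddD oddM andbF.
    by case: (p %% 4)%N (ltn_pmod p (isT : 0 < 4)%N) => [|[|[|[|]]]].
  (* Now alpha = r^2 is nonzero, so (s/r)^2 = -1. *)
  apply: (opp1_not_square pm3); exists (s / r).
  by rewrite expr_div_n es er mulNr divff.
split; first by apply: C_set_sphere; rewrite ?cF.
by rewrite -[X in (X ^ 2 - X)%N]cF; apply: card_sphere_ge; rewrite ?cF.
Qed.
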